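(* Let $n\geq 2$. Let $X$ and $Y$ be $n$-dimensional vector spaces over $\mathbb F_2$, and let $\mathcal G(n)$ be the group with underlying set $X\oplus Y\oplus(X\otimes Y)$ and multiplication $g_1g_2=g_1+g_2+x_2\otimes y_1$ for $g_i=x_i+y_i+A_i$ ($x_i\in X$, $y_i\in Y$, $A_i\in X\otimes Y$, $i=1,2$). Let $\widetilde{\mathcal G}(n)$ be the group with generators $x_1,\ldots,x_n,y_1,\ldots,y_n$ and defining relations, for all $1\le i,j,k\le n$, $$x_i^2=y_i^2=1,\quad [x_i,x_j]=[y_i,y_j]=1,\quad [x_i,y_j]^2=1,\quad [[x_i,y_j],x_k]=[[x_i,y_j],y_k]=1.$$ Then $\mathcal G(n)\cong\widetilde{\mathcal G}(n)$.
   Context: The tensor product is over $\mathbb F_2$, additions in the multiplication formula are in the $\mathbb F_2$-vector space $X\oplus Y\oplus(X\otimes Y)$, and $[a,b]=a^{-1}b^{-1}ab$. *)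

(* Defs.v *)
From HB Require Import structures.
From mathcomp Require Import all_boot all_algebra.
From mathcomp Require Import boolp.

Set Implicit Arguments.
Unset Strict Implicit.
Unset Printing Implicit Defensive.

Import GRing.Theory.

(* A multiplicative map between groups preserves 1 and inverses. *)
Definition group_isomorphic (G H : groupType) : Prop :=
  exists f : {multiplicative G -> H}, bijective f.

Section TensorProduct.
Local Open Scope ring_scope.
Variable F : fieldType.

(* MathComp has no tensor product; [(T, t)] is characterized by its universal
   property, [f =1 g] being the uniqueness of the factorization. *)
Definition is_tensor_product (U V T : lmodType F)
    (t : {bilinear U -> V -> T}) : Prop :=
  forall (W : lmodType F) (b : {bilinear U -> V -> W}),
  exists2 f : {linear T -> W}, forall u v, f (t u v) = b u v &
    forall g : {linear T -> W}, (forall u v, g (t u v) = b u v) -> f =1 g.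

Import VectorInternalTheory.

(* In finite dimension, matrices provide a tensor product. *)
Definition tensor_mx (U V : vectType F) (u : U) (v : V) :
    'M[F]_(dim U, dim V) := (v2r u)^T *m v2r v.

Fact tensor_mx_bilinear (U V : vectType F) :
  bilinear_for (GRing.Scale.Law.clone _ _ *:%R _)
    (GRing.Scale.Law.clone _ _ *:%R _) (@tensor_mx U V).
Proof.
split=> [v a u1 u2|u a v1 v2] /=; rewrite /tensor_mx linearP.
  by rewrite linearP /= mulmxDl -scalemxAl.
by rewrite mulmxDr -scalemxAr.
Qed.

HB.instance Definition _ (U V : vectType F) := bilinear_isBilinear.Build F U V
  'M[F]_(dim U, dim V) _ _ (@tensor_mx U V) (@tensor_mx_bilinear U V).

Lemma tensor_mxP (U V : vectType F) :
  is_tensor_product (@tensor_mx U V : {bilinear U -> V -> 'M[F]_(_, _)}).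
Proof.
move=> W b; pose e i := r2v (delta_mx 0 i) : U; pose e' j := r2v (delta_mx 0 j) : V.
pose f (M : 'M[F]_(dim U, dim V)) := \sum_i \sum_j M i j *: b (e i) (e' j).
have fP : linear f.
  move=> a M N; rewrite /f scaler_sumr -big_split; apply: eq_bigr => i _ /=.
  rewrite scaler_sumr -big_split; apply: eq_bigr => j _ /=.
  by rewrite !mxE scalerDl scalerA.
pose fL := HB.pack_for {linear _ -> _} f (GRing.isLinear.Build _ _ _ _ f fP).
have vE (S : vectType F) (x : S) : x = \sum_i v2r x 0 i *: r2v (delta_mx 0 i).
  rewrite -[LHS]v2rK [in LHS](row_sum_delta (v2r x)) linear_sum.
  by apply: eq_bigr => i _; rewrite linearZ.
exists fL => [u v|g gP M].
  rewrite /= /f [in RHS](vE _ u) linear_sumlz; apply: eq_bigr => i _.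
  rewrite linearZl_LR [in RHS](vE _ v) linear_sumr scaler_sumr.
  apply: eq_bigr => j _; rewrite linearZr_LR scalerA; congr (_ *: _).
  by rewrite mxE big_ord1 mxE.
rewrite [in RHS](matrix_sum_delta M) linear_sum; apply: eq_bigr => i _.
rewrite linear_sum; apply: eq_bigr => j _; rewrite linearZ -gP. congr (_ *: g _).
by rewrite /= /tensor_mx /e /e' !r2vK trmx_delta mul_delta_mx.
Qed.

End TensorProduct.

Section GroupOnTensor.
Local Open Scope ring_scope.
Variables (X Y T : lmodType 'F_2) (t : {bilinear X -> Y -> T}).

(* ((x, y), A) stands for x + y + A. The type mentions t, on which only the
   multiplication depends, so that t determines the group structure. *)
Definition tensor_group of {bilinear X -> Y -> T} : Type := X * Y * T.

HB.instance Definition _ := Choice.on (tensor_group t).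

Implicit Types g : X * Y * T.

Definition tensor_group_mul g1 g2 : X * Y * T :=
  g1 + g2 + (0, 0, t g2.1.1 g1.1.2).

Definition tensor_group_inv g : X * Y * T := - g + (0, 0, t g.1.1 g.1.2).

Let triple_eq g h : g.1.1 = h.1.1 -> g.1.2 = h.1.2 -> g.2 = h.2 -> g = h.
Proof. by case: g h => [[? ?] ?] [[? ?] ?] /= -> -> ->. Qed.

Fact tensor_group_mulA : associative tensor_group_mul.
Proof.
move=> [[x1 y1] A1] [[x2 y2] A2] [[x3 y3] A3].
apply: triple_eq; rewrite /= ?addr0 ?addrA // linearDl linearDr !addrA.
by rewrite [LHS](ACl (1*2*5*3*6*4)).
Qed.

Fact tensor_group_mul1g : left_id (0 : X * Y * T) tensor_group_mul.
Proof. by move=> [[x y] A]; apply: triple_eq; rewrite /= ?linear0r !add0r ?addr0. Qed.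

Fact tensor_group_mulg1 : right_id (0 : X * Y * T) tensor_group_mul.
Proof. by move=> [[x y] A]; apply: triple_eq; rewrite /= ?linear0l !addr0. Qed.

Fact tensor_group_mulVg :
  left_inverse (0 : X * Y * T) tensor_group_inv tensor_group_mul.
Proof.
move=> [[x y] A]; apply: triple_eq; rewrite /= ?addr0 ?addNr //.
by rewrite linearNr [LHS](ACl (1*3*2*4)) /= addNr add0r addrN.
Qed.

Fact tensor_group_mulgV :
  right_inverse (0 : X * Y * T) tensor_group_inv tensor_group_mul.
Proof.
move=> [[x y] A]; apply: triple_eq; rewrite /= ?addr0 ?addrN //.
by rewrite linearNl addrA addrN add0r addrN.
Qed.

HB.instance Definition _ := isGroup.Build (tensor_group t) tensor_group_mulA
  tensor_group_mul1g tensor_group_mulg1 tensor_group_mulVg tensor_group_mulgV.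

End GroupOnTensor.

Section Presentation.

(* A word in the generators: [(i, true)] is the generator i and [(i, false)]
   its formal inverse. *)
Definition word (I : Type) := seq (I * bool).

Definition word_gen I (i : I) : word I := [:: (i, true)].

Definition word_inv I (w : word I) : word I :=
  rev [seq (l.1, ~~ l.2) | l <- w].

(* [a, b] = a^-1 b^-1 a b *)
Definition word_comm I (a b : word I) : word I :=
  word_inv a ++ word_inv b ++ a ++ b.

(* Equality of the elements represented by two words in the group generated by
   I and subject to r = 1 for all r satisfying [rels]. *)
Inductive pres_eq I (rels : word I -> Prop) : word I -> word I -> Prop :=
| PresRefl u : pres_eq rels u u
| PresSym u v : pres_eq rels u v -> pres_eq rels v u
| PresTrans u v w : pres_eq rels u v -> pres_eq rels v w -> pres_eq rels u w
| PresCancel u v l :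
    pres_eq rels (u ++ [:: l; (l.1, ~~ l.2)] ++ v) (u ++ v)
| PresRel u v r : rels r -> pres_eq rels (u ++ r ++ v) (u ++ v).

Variables (I : choiceType) (rels : word I -> Prop).

Definition pres_rel : rel (seq (I * bool)) := fun u v => `[< pres_eq rels u v >].

Fact pres_rel_equiv : equiv_class_of pres_rel.
Proof.
split=> [u|u v|v u w]; rewrite /pres_rel.
- by apply/asboolP; apply: PresRefl.
- by apply/asboolP/asboolP; apply: PresSym.
- by move=> /asboolP uv /asboolP vw; apply/asboolP; apply: PresTrans vw.
Qed.

Canonical pres_equiv := EquivRelPack pres_rel_equiv.

Definition presented_group : Type := {eq_quot pres_equiv}%qT.

HB.instance Definition _ := Choice.on presented_group.
HB.instance Definition _ := EqQuotient.on presented_group.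

Definition pres_class (w : word I) : presented_group :=
  (\pi_({eq_quot pres_equiv}) w)%qT.

Fact pres_classP u v : pres_class u = pres_class v <-> pres_eq rels u v.
Proof.
by split=> [/eqquotP/asboolP //|uv]; apply/eqquotP/asboolP.
Qed.

Definition pres_one : presented_group := pres_class [::].
Definition pres_mul (a b : presented_group) : presented_group :=
  pres_class (repr a ++ repr b).
Definition pres_inv (a : presented_group) : presented_group :=
  pres_class (word_inv (repr a)).

Lemma pres_eq_cat u u' v v' : pres_eq rels u u' -> pres_eq rels v v' ->
  pres_eq rels (u ++ v) (u' ++ v').
Proof.
move=> uu' vv'; apply: (@PresTrans _ _ _ (u' ++ v)).
  elim: uu' => [w|w z _|w z s _ IH _ /(PresTrans IH)|w z l|w z r rr] //.
  - exact: PresRefl.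
  - exact: PresSym.
  - by rewrite -!catA; apply: PresCancel.
  - by rewrite -!catA; apply: PresRel.
elim: vv' => [w|w z _|w z s _ IH _ /(PresTrans IH)|w z l|w z r rr] //.
- exact: PresRefl.
- exact: PresSym.
- by rewrite !(catA u'); apply: PresCancel.
- by rewrite !(catA u'); apply: PresRel.
Qed.

Lemma pres_class_cat u v :
  pres_class (u ++ v) = pres_mul (pres_class u) (pres_class v).
Proof.
by apply/pres_classP/pres_eq_cat; apply/pres_classP; rewrite [RHS]reprK.
Qed.

Lemma word_invK : involutive (@word_inv I).
Proof.
move=> w; rewrite /word_inv map_rev revK -map_comp -[RHS]map_id.
by apply: eq_map => -[i b] /=; rewrite negbK.
Qed.

Lemma pres_eq_invr w : pres_eq rels (w ++ word_inv w) [::].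
Proof.
elim: w => [|l w IHw]; first exact: PresRefl.
have -> : (l :: w) ++ word_inv (l :: w) =
    [:: l] ++ (w ++ word_inv w) ++ [:: (l.1, ~~ l.2)].
  by rewrite /word_inv /= rev_cons -cats1 catA.
apply: (PresTrans _ (@PresCancel _ rels [::] [::] l)).
apply: (@pres_eq_cat [:: l] [:: l] _ [:: (l.1, ~~ l.2)]); first exact: PresRefl.
by apply: (pres_eq_cat IHw); apply: PresRefl.
Qed.

Lemma pres_eq_invl w : pres_eq rels (word_inv w ++ w) [::].
Proof. by rewrite -{2}[w]word_invK; apply: pres_eq_invr. Qed.

Fact pres_mulA : associative pres_mul.
Proof.
move=> a b c; rewrite -[a]reprK -[b]reprK -[c]reprK -!/(pres_class _).
by rewrite -!pres_class_cat catA.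
Qed.

Fact pres_mul1g : left_id pres_one pres_mul.
Proof. by move=> a; rewrite -[a]reprK -!/(pres_class _) -pres_class_cat. Qed.

Fact pres_mulg1 : right_id pres_one pres_mul.
Proof.
by move=> a; rewrite -[a]reprK -!/(pres_class _) -pres_class_cat cats0.
Qed.

Fact pres_mulVg : left_inverse pres_one pres_inv pres_mul.
Proof.
move=> a; rewrite -[X in pres_mul _ X]reprK -!/(pres_class _) -pres_class_cat.
exact/pres_classP/pres_eq_invl.
Qed.

Fact pres_mulgV : right_inverse pres_one pres_inv pres_mul.
Proof.
move=> a; rewrite -[X in pres_mul X _]reprK -!/(pres_class _) -pres_class_cat.
exact/pres_classP/pres_eq_invr.
Qed.

HB.instance Definition _ := isGroup.Build presented_group
  pres_mulA pres_mul1g pres_mulg1 pres_mulVg pres_mulgV.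

End Presentation.

Section TildeG.
Variable n : nat.

(* [inl i] is x_i and [inr i] is y_i. *)
Local Notation x i := (word_gen (inl i : 'I_n + 'I_n)).
Local Notation y i := (word_gen (inr i : 'I_n + 'I_n)).

Inductive tildeG_relator : word ('I_n + 'I_n)%type -> Prop :=
| Rel_xx i : tildeG_relator (x i ++ x i)
| Rel_yy i : tildeG_relator (y i ++ y i)
| Rel_comm_xx i j : tildeG_relator (word_comm (x i) (x j))
| Rel_comm_yy i j : tildeG_relator (word_comm (y i) (y j))
| Rel_comm_xy2 i j :
    tildeG_relator (word_comm (x i) (y j) ++ word_comm (x i) (y j))
| Rel_comm_xyx i j k :
    tildeG_relator (word_comm (word_comm (x i) (y j)) (x k))
| Rel_comm_xyy i j k :
    tildeG_relator (word_comm (word_comm (x i) (y j)) (y k)).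

Definition tildeG := presented_group tildeG_relator.

End TildeG.

(* Main.v *)
(* In coordinates with respect to bases e_i of X and e'_j of Y, every element of
   G(n) is a product of the involutions e_i, e'_j and e_i (x) e'_j, the last of
   which are central and equal to the commutators [e'_j, e_i]. The e_i and e'_j
   satisfy the relations of G~(n), whence a morphism g : G~(n) -> G(n).
   Conversely, the relations of G~(n) make the commutators [y_j, x_i] central
   involutions, so that
     prod y_j^(d_j) . prod x_i^(c_i)
       = prod x_i^(c_i) . prod y_j^(d_j) . prod [y_j, x_i]^(c_i d_j)
   and sending a vector to the product of the generators raised to its
   coordinates is a morphism f : G(n) -> G~(n). The composites f g and g f fix
   the generators, so that f and g are mutually inverse. *)
Require Import Defs.
From HB Require Import structures.
From mathcomp Require Import all_boot all_algebra.
From mathcomp Require Import boolp.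

Set Implicit Arguments.
Unset Strict Implicit.
Unset Printing Implicit Defensive.

Import GRing.Theory.

(** * Group morphisms and evaluation of words *)

Section GroupMorphism.
Local Open Scope group_scope.
Variables (G H : groupType) (f : G -> H).

Lemma morphM_morphism : {morph f : a b / a * b} ->
  exists g : UMagmaMorphism.type G H, g =1 f.
Proof.
move=> fM; have f1 : f 1 = 1 by apply: (mulgI (f 1)); rewrite -fM !mulg1.
by exists (HB.pack_for (UMagmaMorphism.type G H) f
  (isUMagmaMorphism.Build _ _ f (f1, fM))).
Qed.

End GroupMorphism.

Section WordEvaluation.
Local Open Scope group_scope.
Variables (I : choiceType) (G : groupType).

Definition word_eval (phi : I -> G) (w : word I) : G :=
  \prod_(l <- w) (if l.2 then phi l.1 else (phi l.1)^-1).

Implicit Types (phi : I -> G) (u v w : word I).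

Lemma word_eval_gen phi i : word_eval phi (word_gen i) = phi i.
Proof. exact: big_seq1. Qed.

Lemma word_eval_cat phi u v :
  word_eval phi (u ++ v) = word_eval phi u * word_eval phi v.
Proof. exact: big_cat. Qed.

Lemma word_eval_inv phi w : word_eval phi (word_inv w) = (word_eval phi w)^-1.
Proof.
elim: w => [|[i b] w IHw]; first by rewrite /word_eval !big_nil invg1.
rewrite /word_inv /= rev_cons -cats1 word_eval_cat [X in X * _]IHw.
rewrite /word_eval big_seq1 big_cons invgM /=.
by case: b; rewrite //= invgK.
Qed.

Lemma word_eval_comm phi u v :
  word_eval phi (word_comm u v) = [~ word_eval phi u, word_eval phi v].
Proof. by rewrite /word_comm !word_eval_cat !word_eval_inv. Qed.

Definition word_evalE := (word_eval_comm, word_eval_cat, word_eval_gen).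

Variable rels : word I -> Prop.

(** Induction on the derivation: neither cancelling a letter against its formal inverse nor deleting
    a relator changes the value. *)
Lemma word_eval_pres_eq phi u v :
    (forall r, rels r -> word_eval phi r = 1) ->
  pres_eq rels u v -> word_eval phi u = word_eval phi v.
Proof.
move=> relsP; elim=> {u v} [//|u v _ ->//|u v w _ -> _ //|u v [i b]|u v r rr].
  rewrite !word_eval_cat; congr (_ * _); rewrite -[RHS]mul1g; congr (_ * _).
  rewrite /word_eval !big_cons big_nil mulg1 /=.
  by case: b; rewrite /= ?mulgV ?mulVg.
by rewrite !word_eval_cat (relsP r rr) mul1g.
Qed.

(** Von Dyck's theorem: evaluating the chosen representative is multiplicative because equivalent
    words have equal values. *)
Lemma presented_group_morph phi :
    (forall r, rels r -> word_eval phi r = 1) ->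
  exists g : UMagmaMorphism.type (presented_group rels) G,
    forall i, g (pres_class rels (word_gen i)) = phi i.
Proof.
move=> relsP; pose g (a : presented_group rels) := word_eval phi (repr a).
have gE w : g (pres_class rels w) = word_eval phi w.
  by apply: (word_eval_pres_eq relsP); apply/pres_classP; rewrite [LHS]reprK.
have gM : {morph g : a b / a * b} by move=> a b; rewrite gE word_eval_cat.
have [h hE] := morphM_morphism gM.
by exists h => i; rewrite hE gE word_eval_gen.
Qed.

End WordEvaluation.

(** * Generators and relations inside a presented group *)

Section PresentedGroup.
Local Open Scope group_scope.
Variables (I : choiceType) (rels : word I -> Prop).
Local Notation P := (presented_group rels).
Local Notation gen i := (pres_class rels (word_gen i) : P).

(** Turns relators into equations between products in the group, and shows that the classes of the
    generators generate it. *)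
Lemma pres_class_eval w :
  (pres_class rels w : P) = word_eval (fun i => gen i) w.
Proof.
elim: w => [|[i b] w IHw]; first by rewrite /word_eval big_nil.
rewrite -cat1s pres_class_cat IHw word_eval_cat; congr (_ * _).
case: b; first by rewrite word_eval_gen.
rewrite (_ : [:: (i, false)] = word_inv (word_gen i)) // word_eval_inv.
rewrite word_eval_gen; apply: (mulIg (gen i)); rewrite mulVg.
rewrite -[LHS]pres_class_cat; exact/pres_classP/pres_eq_invl.
Qed.

Lemma pres_rel1 r : rels r -> word_eval (fun i => gen i) r = 1.
Proof.
move=> rr; rewrite -pres_class_eval; apply/pres_classP.
by have := PresRel [::] [::] rr; rewrite cats0.
Qed.

Lemma presented_group_gen (a : P) : exists w, a = word_eval (fun i => gen i) w.
Proof. by exists (repr a); rewrite -pres_class_eval; apply/esym/reprK. Qed.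

(** The elements commuting with [z] are closed under products and inverses. *)
Lemma pres_commute (z : P) :
  (forall i, commute z (gen i)) -> forall a, commute z a.
Proof.
move=> zgen a; have [w ->] := presented_group_gen a.
apply: commute_prod => -[i []] _ //=; exact: commuteV.
Qed.

Lemma pres_morph_ext (G : groupType) (f g : UMagmaMorphism.type P G) :
  (forall i, f (gen i) = g (gen i)) -> f =1 g.
Proof.
move=> fg a; have [w ->] := presented_group_gen a.
elim: w => [|[i b] w IHw]; first by rewrite /word_eval big_nil !gmulf1.
rewrite -cat1s word_eval_cat !gmulfM IHw; congr (_ * _).
by case: b; rewrite /word_eval big_seq1 //= !gmulfV fg.
Qed.

End PresentedGroup.

(** * Products of powers with exponents in F_2 *)

Section ProductsOfPowers.
Local Open Scope group_scope.
Variable G : groupType.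

Lemma F2_eq0_or_eq1 (c : 'F_2) : c = 0%R \/ c = 1%R.
Proof.
by case: c => [[|[|m]] lt] //; [left|right]; apply: val_inj.
Qed.

(** The exponent is read as the natural number 0 or 1. Reduction modulo 2 matters only when c = d =
    1, where [a * a = 1] absorbs it. *)
Lemma expgF2D (a : G) : a * a = 1 ->
  {morph (fun c : 'F_2 => a ^+ c) : c d / (c + d)%R >-> c * d}.
Proof.
by move=> aa c d; case: (F2_eq0_or_eq1 c) (F2_eq0_or_eq1 d) => -> [] ->;
  rewrite /= ?expg0 ?expg1 ?mul1g ?mulg1 ?aa.
Qed.

Lemma prodg_morphD (I : finType) (V : zmodType) (F : I -> V -> G) :
    (forall i, {morph F i : u v / (u + v)%R >-> u * v}) ->
    (forall i j u v, commute (F i u) (F j v)) ->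
  {morph (fun u => \prod_i F i u) : u v / (u + v)%R >-> u * v}.
Proof.
move=> FD Fcomm u v; rewrite -prodgM_commute; last by move=> *; apply: Fcomm.
by apply: eq_bigr => i _; apply: FD.
Qed.

(** Rebuilds a vector from its coordinates inside the group. Since the scalars are 0 or 1,
    additivity of [j] suffices. *)
Lemma prodg_exp_morph (I : finType) (V : lmodType 'F_2) (j : V -> G)
    (c : I -> 'F_2) (e : I -> V) :
    {morph j : u v / (u + v)%R >-> u * v} ->
  \prod_i j (e i) ^+ c i = j (\sum_i c i *: e i)%R.
Proof.
move=> jD; have j0 : j 0%R = 1.
  by apply: (mulgI (j 0%R)); rewrite -jD addr0 mulg1.
rewrite (big_morph j jD j0); apply: eq_bigr => i _.
by case: (F2_eq0_or_eq1 (c i)) => ->; rewrite ?scale0r ?scale1r ?expg0 ?expg1.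
Qed.

Lemma prodg_exp_delta (I : finType) (a : I -> G) (c : I -> 'F_2) i :
  (forall j, c j = (j == i)%:R)%R -> \prod_j a j ^+ c j = a i.
Proof.
move=> cE; rewrite (big_only1 i) ?cE ?eqxx ?expg1 // => j /negPf ji _.
by rewrite cE ji expg0.
Qed.

Lemma prodg_exp0 (I : finType) (a : I -> G) (c : I -> 'F_2) :
  (forall j, c j = 0)%R -> \prod_j a j ^+ c j = 1.
Proof. by move=> c0; apply: big1 => j _; rewrite c0 expg0. Qed.

(** Each time [b] crosses a factor [a i] it leaves behind [z i], which is central and can be moved
    to the far right. *)
Lemma swap_prodr (I : Type) (r : seq I) (b : G) (a z : I -> G) :
    (forall i, b * a i = a i * b * z i) -> (forall i h, commute (z i) h) ->
  b * \prod_(i <- r) a i = \prod_(i <- r) a i * b * \prod_(i <- r) z i.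
Proof.
move=> baE zC; elim: r => [|i r IHr]; first by rewrite !big_nil !mulg1 mul1g.
rewrite !big_cons mulgA baE -[LHS]mulgA (zC _ (\prod_(j <- r) a j)).
by rewrite [LHS]mulgA -(mulgA (a i)) IHr -!mulgA -(zC i).
Qed.

Lemma swap_prodl (I : Type) (r : seq I) (b : G) (a z : I -> G) :
    (forall i, a i * b = b * a i * z i) -> (forall i h, commute (z i) h) ->
  \prod_(i <- r) a i * b = b * \prod_(i <- r) a i * \prod_(i <- r) z i.
Proof.
move=> abE zC; elim: r => [|i r IHr]; first by rewrite !big_nil !mulg1 mul1g.
rewrite !big_cons -mulgA IHr !mulgA abE -!mulgA; congr (_ * (_ * _)).
by rewrite !mulgA -zC.
Qed.

End ProductsOfPowers.

(** * The three components of the group on triples *)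

Section TensorGroup.
Local Open Scope group_scope.
Variables (X Y T : lmodType 'F_2) (t : {bilinear X -> Y -> T}%R).
Local Notation G := (tensor_group t).

Definition in_left (x : X) : G := (x, 0%R, 0%R).
Definition in_right (y : Y) : G := (0%R, y, 0%R).
Definition in_tensor (A : T) : G := (0%R, 0%R, A).

Lemma tensor_groupM (g h : G) :
  g * h = (g.1.1 + h.1.1, g.1.2 + h.1.2, g.2 + h.2 + t h.1.1 g.1.2)%R.
Proof.
rewrite [LHS](_ : _ = tensor_group_mul t g h) // /tensor_group_mul.
by case: g h => [[x y] A] [[x' y'] A']; congr (_, _, _); rewrite /= addr0.
Qed.

Lemma in_leftD : {morph in_left : u v / (u + v)%R >-> u * v}.
Proof. by move=> u v; rewrite tensor_groupM /= linear0r !addr0. Qed.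

Lemma in_rightD : {morph in_right : u v / (u + v)%R >-> u * v}.
Proof. by move=> u v; rewrite tensor_groupM /= linear0l !addr0. Qed.

Lemma in_tensorD : {morph in_tensor : u v / (u + v)%R >-> u * v}.
Proof. by move=> u v; rewrite tensor_groupM /= linear0l !addr0. Qed.

(** In this order of the factors every twisting term has a zero argument and vanishes. *)
Lemma tensor_groupE (g : G) :
  g = in_left g.1.1 * in_right g.1.2 * in_tensor g.2.
Proof.
case: g => [[x y] A]; rewrite !tensor_groupM /=.
by rewrite !linear0l !addr0 !add0r.
Qed.

Lemma in_tensorC A (g : G) : commute (in_tensor A) g.
Proof.
case: g => [[x y] B]; rewrite /commute !tensor_groupM /=.
by rewrite linear0l linear0r !addr0 !add0r addrC.
Qed.

Lemma in_leftC u v : commute (in_left u) (in_left v).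
Proof. by rewrite /commute -!in_leftD addrC. Qed.

Lemma in_rightC u v : commute (in_right u) (in_right v).
Proof. by rewrite /commute -!in_rightD addrC. Qed.

(** Of the two orders of multiplication only right before left picks up the twist [t x y], so the
    orders differ by exactly this central element. *)
Lemma in_right_left x y :
  [~ in_right y, in_left x] = in_tensor (t x y).
Proof.
apply: (mulgI (in_left x * in_right y)); rewrite -commgC !tensor_groupM /=.
by rewrite !linear0l ?linear0r !addr0 !add0r.
Qed.

End TensorGroup.

(** * Coordinates on the vector spaces and on their tensor product *)

Lemma addF2 (V : lmodType 'F_2) (v : V) : (v + v = 0)%R.
Proof.
have F2 : (1 + 1 = 0 :> 'F_2)%R by apply: val_inj.
by rewrite -[v]scale1r -scalerDl F2 scale0r.
Qed.

Lemma F2_basis n (V : vectType 'F_2) : \dim {:V} = n ->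
  exists (e : 'I_n -> V) (c : 'I_n -> {linear V -> ('F_2)^o}),
    (forall v, v = \sum_i c i v *: e i)%R /\
    (forall i j, c i (e j) = (i == j)%:R)%R.
Proof.
move=> <-; exists (fun i => (vbasis {:V})`_i)%R, (coord (vbasis {:V})).
split=> [v|i j]; first exact/coord_vbasis/memvf.
by rewrite /= coord_free 1?eq_sym //; apply/basis_free/vbasisP.
Qed.

Section TensorCoordinates.
Local Open Scope ring_scope.
Variables (F : fieldType) (U V T : lmodType F) (t : {bilinear U -> V -> T}).
Hypothesis tP : is_tensor_product t.
Variables (n m : nat) (e : 'I_n -> U) (c : 'I_n -> {linear U -> F^o}).
Variables (e' : 'I_m -> V) (c' : 'I_m -> {linear V -> F^o}).
Hypothesis cE : forall u, u = \sum_i c i u *: e i.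
Hypothesis c'E : forall v, v = \sum_j c' j v *: e' j.

(** The form [p i j] is the factorization through [T] of the bilinear form sending u, v to
    [c i u * c' j v]. The expansion of [A] is checked on pure tensors and extended to [T] by the
    universal property. *)
Lemma tensor_coordinates :
  exists p : 'I_n -> 'I_m -> {linear T -> F^o},
    (forall i j u v, p i j (t u v) = c i u * c' j v) /\
    (forall A, A = \sum_j \sum_i p i j A *: t (e i) (e' j)).
Proof.
have pP i j : exists p : {linear T -> F^o},
    forall u v, p (t u v) = c i u * c' j v.
  pose b (u : U) (v : V) : F^o := c i u * c' j v.
  have bP : bilinear_for (GRing.Scale.Law.clone _ _ *:%R _)
      (GRing.Scale.Law.clone _ _ *:%R _) b.
    split=> [v a u1 u2|u a v1 v2]; rewrite /b linearP /=.
      by rewrite mulrDl -scalerAl.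
    by rewrite mulrDr -scalerAr.
  have [p pE _] := tP (HB.pack_for {bilinear U -> V -> F^o} b
    (bilinear_isBilinear.Build F U V F^o _ _ b bP)).
  by exists p.
have [p' p'E] := choice (fun ij : 'I_n * 'I_m => pP ij.1 ij.2).
pose p i j := p' (i, j).
have pE i j : forall u v, p i j (t u v) = c i u * c' j v.
  exact: p'E (i, j).
exists p; split=> // A.
pose q A := \sum_j \sum_i p i j A *: t (e i) (e' j).
have qP : linear q.
  move=> a A1 A2; rewrite /q scaler_sumr -big_split; apply: eq_bigr => j _ /=.
  rewrite scaler_sumr -big_split; apply: eq_bigr => i _ /=.
  by rewrite linearP scalerDl scalerA.
(* Both [q] and the identity factor [t] through itself, so uniqueness identifies them. *)
have [f _ fU] := tP t.
rewrite -[LHS](fU idfun) // (fU (HB.pack_for {linear T -> T} q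
  (GRing.isLinear.Build _ _ _ _ q qP))) //= => u v.
rewrite /q [in RHS](c'E v) linear_sumr; apply: eq_bigr => j _.
rewrite linearZr_LR [in RHS](cE u) linear_sumlz scaler_sumr.
by apply: eq_bigr => i _; rewrite linearZl_LR scalerA pE mulrC.
Qed.

End TensorCoordinates.

(** * Morphisms out of the group on triples *)

Section TensorGroupMorphism.
Local Open Scope group_scope.
Variables (X Y T : lmodType 'F_2) (t : {bilinear X -> Y -> T}%R).
Variables (n : nat) (c : 'I_n -> {linear X -> ('F_2)^o}%R).
Variables (c' : 'I_n -> {linear Y -> ('F_2)^o}%R).
Variables (p : 'I_n -> 'I_n -> {linear T -> ('F_2)^o}%R).
Hypothesis pE : forall i j u v, (p i j (t u v) = c i u * c' j v)%R.
Variables (H : groupType) (a b : 'I_n -> H).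
(** This order of the commutator gives [b j * a i = a i * b j * z i j], matching the twist of the
    group law. *)
Let z i j := [~ b j, a i].
Hypothesis aa : forall i, a i * a i = 1.
Hypothesis bb : forall i, b i * b i = 1.
Hypothesis zz : forall i j, z i j * z i j = 1.
Hypothesis aC : forall i j, commute (a i) (a j).
Hypothesis bC : forall i j, commute (b i) (b j).
Hypothesis zC : forall i j h, commute (z i j) h.

Let left_part (x : X) := \prod_i a i ^+ (c i x : 'F_2).
Let right_part (y : Y) := \prod_j b j ^+ (c' j y : 'F_2).
Let tensor_part (A : T) := \prod_j \prod_i z i j ^+ (p i j A : 'F_2).

Let expD (V : lmodType 'F_2) (h : H) (l : {linear V -> ('F_2)^o}%R) :
  h * h = 1 -> {morph (fun v => h ^+ (l v : 'F_2)) : u v / (u + v)%R >-> u * v}.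
Proof. by move=> hh u v; rewrite linearD; apply: expgF2D. Qed.

Let left_partD : {morph left_part : u v / (u + v)%R >-> u * v}.
Proof.
by apply: prodg_morphD => [i|i j u v]; [apply: expD | apply: commuteX2].
Qed.

Let right_partD : {morph right_part : u v / (u + v)%R >-> u * v}.
Proof.
by apply: prodg_morphD => [i|i j u v]; [apply: expD | apply: commuteX2].
Qed.

Let z_expC i j m h : commute (z i j ^+ m) h.
Proof. exact/commute_sym/commuteX/commute_sym/zC. Qed.

Let z_prodC j (F : 'I_n -> nat) h : commute (\prod_i z i j ^+ F i) h.
Proof. by apply/commute_sym/commute_prod => i _; apply/commute_sym/z_expC. Qed.

Let tensor_partC A h : commute (tensor_part A) h.
Proof. by apply/commute_sym/commute_prod => j _; apply/commute_sym/z_prodC. Qed.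

Let tensor_partD : {morph tensor_part : u v / (u + v)%R >-> u * v}.
Proof.
apply: prodg_morphD => [j|i j u v]; last exact: z_prodC.
by apply: prodg_morphD => [i|i i' u v]; [apply: expD | apply: z_expC].
Qed.

(** Each factor of [right_part y] crosses all of [left_part x], one factor at a time. A crossing
    leaves the central [z i j] exactly when both exponents are 1, that is, to the power
    [c i x * c' j y]. *)
Let right_left x y :
  right_part y * left_part x = left_part x * right_part y * tensor_part (t x y).
Proof.
apply: swap_prodl => [j|j h]; last exact: z_prodC.
apply: swap_prodr => [i|i h]; last exact: z_expC.
rewrite pE; case: (F2_eq0_or_eq1 (c i x)) (F2_eq0_or_eq1 (c' j y)) => -> [] ->.
- by rewrite mul0r !expg0 !mulg1.
- by rewrite mul0r !expg0 !mulg1 mul1g.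
- by rewrite mulr0 !expg0 !mulg1 mul1g.
- by rewrite mulr1 !expg1 commgC.
Qed.

(** To multiply two such normal forms, the right part of the first must cross the left part of the
    second. By [right_left] this costs the image of the twisting term of the group law; all else is
    additivity and centrality. *)
Lemma tensor_group_morph : exists f : UMagmaMorphism.type (tensor_group t) H,
  forall g : tensor_group t,
    f g = \prod_i a i ^+ (c i g.1.1 : 'F_2) * \prod_j b j ^+ (c' j g.1.2 : 'F_2)
      * \prod_j \prod_i z i j ^+ (p i j g.2 : 'F_2).
Proof.
pose f (g : tensor_group t) :=
  left_part g.1.1 * right_part g.1.2 * tensor_part g.2.
have fM : {morph f : g h / g * h}.
  move=> g h; rewrite tensor_groupM /f /= left_partD right_partD !tensor_partD.
  rewrite -(mulgA _ (tensor_part g.2)) (tensor_partC g.2 (_ * _)) !mulgA.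
  rewrite -(mulgA _ (right_part g.1.2) (left_part h.1.1)) right_left !mulgA.
  rewrite -(mulgA _ (tensor_part (t _ _)) (right_part _)) tensor_partC -!mulgA.
  do 4![congr (_ * _)]; rewrite [RHS]tensor_partC mulgA.
  by rewrite (tensor_partC g.2).
by have [h hE] := morphM_morphism fM; exists h.
Qed.

End TensorGroupMorphism.

(** * The relations of the presented group as equations *)

Section TildeG.
Local Open Scope group_scope.
Variable n : nat.
Local Notation rels := (@tildeG_relator n).

Definition tilde_x i : tildeG n := pres_class rels (word_gen (inl i)).
Definition tilde_y i : tildeG n := pres_class rels (word_gen (inr i)).

Let rel1 := (@pres_rel1 _ rels).

Lemma tilde_xx i : tilde_x i * tilde_x i = 1.
Proof. by have := rel1 (Rel_xx i); rewrite !word_evalE. Qed.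

Lemma tilde_yy i : tilde_y i * tilde_y i = 1.
Proof. by have := rel1 (Rel_yy i); rewrite !word_evalE. Qed.

Lemma tilde_xC i j : commute (tilde_x i) (tilde_x j).
Proof.
by have := rel1 (Rel_comm_xx i j); rewrite !word_evalE => ?; apply/commgP/eqP.
Qed.

Lemma tilde_yC i j : commute (tilde_y i) (tilde_y j).
Proof.
by have := rel1 (Rel_comm_yy i j); rewrite !word_evalE => ?; apply/commgP/eqP.
Qed.

(** The relator concerns the opposite commutator, which is the inverse of this one. *)
Lemma tilde_comm2 i j : [~ tilde_y j, tilde_x i] * [~ tilde_y j, tilde_x i] = 1.
Proof.
have := rel1 (Rel_comm_xy2 i j); rewrite !word_evalE.
rewrite -/(tilde_x i) -/(tilde_y j).
by rewrite -[[~ tilde_y _, _]]invgR -invgM => ->; rewrite invg1.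
Qed.

(** The last two families of relators give commutation with the generators, hence with the whole
    group. *)
Lemma tilde_commC i j h : commute [~ tilde_y j, tilde_x i] h.
Proof.
rewrite -[[~ tilde_y _, _]]invgR; apply/commute_sym/commuteV/commute_sym.
apply: pres_commute => -[k|k]; apply/commgP/eqP.
  by have := rel1 (Rel_comm_xyx i j k); rewrite !word_evalE.
by have := rel1 (Rel_comm_xyy i j k); rewrite !word_evalE.
Qed.

End TildeG.

(** * The two morphisms and their composites *)

Theorem lemma5p4 (n : nat) (hn : (2 <= n)%N) (X Y : vectType 'F_2)
    (dimX : \dim {:X} = n) (dimY : \dim {:Y} = n)
    (T : lmodType 'F_2) (t : {bilinear X -> Y -> T}%R)
    (tP : is_tensor_product t) :
  group_isomorphic (tensor_group t) (tildeG n).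
Proof.
have [e [c [cE ce]]] := F2_basis dimX.
have [e' [c' [c'E ce']]] := F2_basis dimY.
have [p [pE pT]] := tensor_coordinates tP cE c'E.
have [f fE] := tensor_group_morph pE (@tilde_xx n) (@tilde_yy n)
  (@tilde_comm2 n) (@tilde_xC n) (@tilde_yC n) (@tilde_commC n).
pose phi (k : 'I_n + 'I_n) : tensor_group t :=
  match k with inl i => in_left t (e i) | inr j => in_right t (e' j) end.
have [|g gE] := @presented_group_morph _ _ (@tildeG_relator n) phi.
  have comm1 (a b : tensor_group t) : commute a b -> [~ a, b]%g = 1%g.
    by move=> ab; apply/eqP/commgP.
  move=> r [i|i|i j|i j|i j|i j k|i j k]; rewrite !word_evalE /=.
  - by rewrite -in_leftD addF2.
  - by rewrite -in_rightD addF2.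
  - exact/comm1/in_leftC.
  - exact/comm1/in_rightC.
  (* The commutator is the inverse of an element of the tensor component, where doubling gives 0. *)
  - by rewrite -invgR in_right_left -invgM -in_tensorD addF2 invg1.
  - apply: comm1; rewrite -invgR in_right_left.
    exact/commute_sym/commuteV/commute_sym/in_tensorC.
  - apply: comm1; rewrite -invgR in_right_left.
    exact/commute_sym/commuteV/commute_sym/in_tensorC.
have gx i : g (tilde_x i) = in_left t (e i) by apply: gE.
have gy i : g (tilde_y i) = in_right t (e' i) by apply: gE.
exists f; exists g => [h|h].
  (* The three products defining [f h] are mapped by [g] to the three components of [h], each
     rebuilt from its coordinates. *)
  rewrite fE !gmulfM [RHS]tensor_groupE; congr (_ * _ * _)%g.
  - rewrite gmulf_prod [in RHS](cE h.1.1).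
    rewrite -(prodg_exp_morph _ _ (@in_leftD _ _ _ t)).
    by apply: eq_bigr => i _; rewrite gmulfXn gx.
  - rewrite gmulf_prod [in RHS](c'E h.1.2).
    rewrite -(prodg_exp_morph _ _ (@in_rightD _ _ _ t)).
    by apply: eq_bigr => i _; rewrite gmulfXn gy.
  have in_tensor0 : in_tensor t 0%R = 1%g by [].
  rewrite gmulf_prod [in RHS](pT h.2).
  rewrite (big_morph _ (@in_tensorD _ _ _ t) in_tensor0).
  apply: eq_bigr => j _.
  rewrite gmulf_prod -(prodg_exp_morph _ _ (@in_tensorD _ _ _ t)).
  by apply: eq_bigr => i _; rewrite gmulfXn gmulfR gx gy in_right_left.
apply: (@pres_morph_ext _ _ _ (f \o g) idfun) => -[i|i] /=.
  (* The coordinates of a basis vector single out one generator; the other two components are 0 and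
     contribute trivial products. *)
  rewrite [g _]gx fE /= (prodg_exp_delta _ (ce^~ i)).
  rewrite prodg_exp0 => [|j]; last exact: linear0.
  rewrite big1 ?mulg1 // => j _; apply: prodg_exp0 => k; exact: linear0.
rewrite [g _]gy fE /= (prodg_exp_delta _ (ce'^~ i)).
rewrite prodg_exp0 => [|j]; last exact: linear0.
rewrite big1 ?mul1g ?mulg1 // => j _.
by apply: prodg_exp0 => k; apply: linear0.
Qed.
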